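(* For every integer $t\ge1$, $$\mathrm{HF}(R^{\overline{D_{2d}}},t)=\frac{2dt^2+(d+\gcd(d,2)+2)t+2}{2}.$$
   Context: Let $k$ be an algebraically closed field of characteristic zero and $R=k[x_0,x_1,x_2]$ with its standard grading. Fix integers $d\ge 3$ and $0<a<\frac d2$ with $\gcd(a,d)=1$, a primitive $2d$-th root of unity $\varepsilon\in k$, and set $e=\varepsilon^2$. The dihedral group $D_{2d}=\langle \tau,\eta \mid \tau^d=\eta^2=(\eta\tau)^2=1\rangle$ of order $2d$ acts linearly on $R$ through the representation $\rho_a:D_{2d}\to \mathrm{GL}(3,k)$ with $\rho_a(\tau)=\mathrm{diag}(1,e^a,e^{d-a})$ and $\rho_a(\eta)$ the permutation matrix fixing $x_0$ and interchanging $x_1$ and $x_2$. Identify $D_{2d}$ with its image. Let $C_{2d}=\langle\varepsilon\,\mathrm{Id}\rangle$ and let $\overline{D_{2d}}=D_{2d}\times C_{2d}\subset \mathrm{GL}(3,k)$ be the subgroup generated by $D_{2d}$ and $C_{2d}$. The ring of invariants $R^{\overline{D_{2d}}}$ is graded by $R^{\overline{D_{2d}}}=\bigoplus_{t\ge0}R^{\overline{D_{2d}}}_t$ with $R^{\overline{D_{2d}}}_t:=R_{2dt}\cap R^{D_{2d}}$, and $\mathrm{HF}(R^{\overline{D_{2d}}},t)=\dim_k R^{\overline{D_{2d}}}_t$ is its Hilbert function. *)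

(* Defs.v *)
From HB Require Import structures.
From mathcomp Require Import all_boot all_order all_algebra.
From mathcomp Require Import mpoly.
From mathcomp Require Import boolp.

Set Implicit Arguments.
Unset Strict Implicit.
Unset Printing Implicit Defensive.

Import GRing.Theory.
Local Open Scope ring_scope.

Section Groups.
Variables (k : fieldType) (n : nat).

Inductive generated (S : 'M[k]_n -> Prop) : 'M[k]_n -> Prop :=
| generated_mem A : S A -> generated S A
| generated_one : generated S 1%:M
| generated_mul A B : generated S A -> generated S B -> generated S (A *m B)
| generated_inv A : generated S A -> generated S (invmx A).

(* [A] acts as the algebra endomorphism sending 'X_j to \sum_i A i j *: 'X_i,
   i.e. by the linear map of matrix [A] in the basis ('X_i) of linear forms. *)
Definition mx_act (A : 'M[k]_n) (p : {mpoly k[n]}) : {mpoly k[n]} :=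
  p \mPo [tuple \sum_(i < n) A i j *: 'X_i | j < n].

Definition mx_invariant (G : 'M[k]_n -> Prop) (p : {mpoly k[n]}) : Prop :=
  forall A, G A -> mx_act A p = p.

End Groups.

Section Dihedral.
Variables (k : fieldType) (d a : nat) (eps : k).

Definition rho_tau : 'M[k]_3 :=
  let e := eps ^+ 2 in diag_mx (\row_(j < 3) [:: 1; e ^+ a; e ^+ (d - a)]`_j).

Definition rho_eta : 'M[k]_3 := tperm_mx (inord 1) (inord 2).

(* The image of the dihedral group of order 2d under the representation. *)
Definition dihedral_mx : 'M[k]_3 -> Prop :=
  generated (fun A => A = rho_tau \/ A = rho_eta).

Definition cyclic_mx : 'M[k]_3 -> Prop := generated (fun A => A = eps%:M).

Definition ext_dihedral_mx : 'M[k]_3 -> Prop :=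
  generated (fun A => dihedral_mx A \/ cyclic_mx A).

End Dihedral.

Lemma mx_act_scalar (k : fieldType) (n : nat) (c : k) (p : {mpoly k[n]}) :
  mx_act c%:M p = \sum_(m <- msupp p) (p@_m * c ^+ mdeg m) *: 'X_[m].
Proof.
rewrite /mx_act comp_mpolyEX; apply: eq_bigr => m _.
rewrite -scalerA comp_mpolyX; congr (_ *: _).
transitivity (\prod_(i < n) (c ^+ m i *: ('X_i ^+ m i : {mpoly k[n]}))).
  apply: eq_bigr => i _; rewrite tnth_mktuple (bigD1 i) //= mxE eqxx mulr1n.
  rewrite big1 ?addr0 ?exprZn // => j /negbTE nij.
  by rewrite mxE nij mulr0n scale0r.
by rewrite scaler_prod prodrXr -mdegE -mpolyXE_id.
Qed.

Lemma mx_act_mul (k : fieldType) (n : nat) (A B : 'M[k]_n) (p : {mpoly k[n]}) :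
  mx_act (A *m B) p = mx_act A (mx_act B p).
Proof.
rewrite /mx_act [p \mPo [tuple _ | j < n] in RHS]comp_mpolyEX raddf_sum /=.
rewrite comp_mpolyEX; apply: eq_bigr => m _; rewrite comp_mpolyZ; congr (_ *: _).
rewrite !comp_mpolyX rmorph_prod /=; apply: eq_bigr => i _.
rewrite rmorphXn /= !tnth_mktuple; congr (_ ^+ _).
rewrite raddf_sum /=.
under [RHS]eq_bigr => j _.
  rewrite comp_mpolyZ comp_mpolyXU -tnth_nth tnth_mktuple scaler_sumr. over.
rewrite [RHS]exchange_big /=.
transitivity (\sum_(j < n) \sum_(l < n) (A j l * B l i) *: ('X_j : {mpoly k[n]})).
  by apply: eq_bigr => j _; rewrite mxE scaler_suml.
change (\sum_(j < n) \sum_(l < n) (A j l * B l i) *: ('X_j : {mpoly k[n]}) =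
  \sum_(j < n) \sum_(l < n) B l i *: (A j l *: ('X_j : {mpoly k[n]}))).
apply: eq_bigr => j _; apply: eq_bigr => l _.
by rewrite scalerA mulrC.
Qed.

Lemma mx_act1 (k : fieldType) (n : nat) (p : {mpoly k[n]}) :
  mx_act 1%:M p = p.
Proof.
rewrite mx_act_scalar [RHS]mpolyE; apply: eq_bigr => m _.
by rewrite expr1n mulr1.
Qed.

Lemma invariant_generated (k : fieldType) (n : nat) (S : 'M[k]_n -> Prop)
    (p : {mpoly k[n]}) :
  (forall A, S A -> A \in unitmx) ->
  mx_invariant (generated S) p <-> mx_invariant S p.
Proof.
move=> unitS; split=> [inv A SA|inv]; first by apply/inv/generated_mem.
suff H A : generated S A -> A \in unitmx /\ mx_act A p = p by move=> A /H[].
elim=> {A} [A SA||A B _ [uA iA] _ [uB iB]|A _ [uA iA]].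
- by split; [apply: unitS | apply: inv].
- by rewrite unitmx1 mx_act1.
- by rewrite unitmx_mul uA uB mx_act_mul iB.
- by rewrite unitmx_inv uA -{1}iA -mx_act_mul mulVmx // mx_act1.
Qed.

Lemma generated_unit (k : fieldType) (n : nat) (S : 'M[k]_n -> Prop) :
  (forall A, S A -> A \in unitmx) -> forall A, generated S A -> A \in unitmx.
Proof.
move=> uS A; elim=> {A} [A /uS||A B _ uA _ uB|A _ uA] //.
- exact: unitmx1.
- by rewrite unitmx_mul uA.
- by rewrite unitmx_inv.
Qed.

(* The ring of invariants of the extended group consists of the invariants of
   the dihedral group whose homogeneous components have degrees divisible by
   2d. *)
Lemma ext_dihedral_invariantP (k : fieldType) (d a : nat) (eps : k)
    (p : {mpoly k[3]}) :
  (0 < d)%N -> (2 * d).-primitive_root eps ->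
  mx_invariant (ext_dihedral_mx d a eps) p <->
  mx_invariant (dihedral_mx d a eps) p /\
  {in msupp p, forall m, (2 * d %| mdeg m)%N}.
Proof.
move=> d0 prim.
have eps0 : eps != 0.
  apply/eqP=> e0; have := prim_expr_order prim.
  by rewrite e0 expr0n muln_eq0 /= eqn0Ngt d0 => /esym/eqP; rewrite oner_eq0.
have uD A : dihedral_mx d a eps A -> A \in unitmx.
  apply: generated_unit => {}A [->|->]; last first.
    by rewrite /rho_eta unitmx_perm.
  rewrite unitmxE det_diag unitfE; apply/prodf_neq0 => i _; rewrite mxE.
  by case: i => [[|[|[|//]]] ?] /=; rewrite ?oner_eq0 ?expf_neq0.
have uC0 (A : 'M[k]_3) : A = eps%:M -> A \in unitmx.
  by move=> ->; rewrite unitmxE det_scalar unitfE; apply: expf_neq0.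
have uC A : cyclic_mx eps A -> A \in unitmx
  by exact: generated_unit uC0 A.
have uE A : dihedral_mx d a eps A \/ cyclic_mx eps A -> A \in unitmx.
  by case; [apply: uD | apply: uC].
have scalP : mx_act eps%:M p = p <->
    {in msupp p, forall m, (2 * d %| mdeg m)%N}.
  rewrite mx_act_scalar; split=> [eqp m mp|div]; last first.
    rewrite [RHS]mpolyE; apply: eq_big_seq => m /div /dvdnP[q ->].
    by rewrite mulnC exprM (prim_expr_order prim) expr1n mulr1.
  have /(congr1 (fun q : {mpoly k[3]} => q@_m)) := eqp.
  rewrite raddf_sum (bigD1_seq m) ?msupp_uniq //= big1 => [|m' nm]; last first.
    by rewrite mcoeffZ mcoeffX (negbTE nm) mulr0.
  rewrite mcoeffZ mcoeffX eqxx mulr1 addr0 -[RHS]mulr1.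
  move/mulfI; rewrite -mcoeff_msupp => /(_ mp) /eqP.
  by rewrite -(prim_order_dvd prim).
rewrite -scalP; split=> [/(invariant_generated p uE) inv|[iD iC]].
  split=> [A DA|]; first by apply: inv; left.
  by apply: inv; right; apply: generated_mem.
apply/(invariant_generated p uE) => A [/iD //|].
by move: A; apply/(invariant_generated p uC0) => A ->.
Qed.

Section Subspace.
Variables (k : fieldType) (vT : vectType k).

Definition linear_subset (P : vT -> Prop) : Prop :=
  P 0 /\ forall c u v, P u -> P v -> P (c *: u + v).

Lemma subspace_exists (P : vT -> Prop) :
  linear_subset P -> exists V : {vspace vT}, forall v, v \in V <-> P v.
Proof.
case=> P0 Plin.
pose Q (m : nat) := `[< exists2 V : {vspace vT},
  (forall v, v \in V -> P v) & \dim V = m >].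
have exQ : exists m, Q m.
  exists 0; apply/asboolP; exists 0%VS; last by rewrite dimv0.
  by move=> v; rewrite memv0 => /eqP->.
have ubQ m : Q m -> (m <= \dim {:vT})%N.
  by case/asboolP=> V _ <-; apply/dimvS/subvf.
case: (ex_maxnP exQ ubQ) => m /asboolP[V sVP dV] maxm.
exists V => v; split; first exact: sVP.
move=> Pv; apply/negPn/negP => nVv.
have /maxm : Q (\dim (<[v]> + V)%VS).
  apply/asboolP; exists (<[v]> + V)%VS => // w.
  case/memv_addP=> x /vlineP[c ->] [y Vy ->].
  by apply: Plin => //; apply: sVP.
rewrite -dV leqNgt => /negP; apply.
rewrite ltnNge; apply: contra nVv => le_dim.
have /eqP eV : V == (<[v]> + V)%VS by rewrite eqEdim addvSr.
by rewrite eV; apply: (subvP (addvSl _ _)); apply: memv_line.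
Qed.

Definition subspace_of (P : vT -> Prop) (HP : linear_subset P) : {vspace vT} :=
  projT1 (cid (subspace_exists HP)).

Lemma mem_subspace_of (P : vT -> Prop) (HP : linear_subset P) (v : vT) :
  v \in subspace_of HP <-> P v.
Proof. exact: (projT2 (cid (subspace_exists HP))) v. Qed.

End Subspace.

Lemma invariant_linear (k : fieldType) (n m : nat) (G : 'M[k]_n.+1 -> Prop) :
  linear_subset (fun p : dhomog n.+1 k m => mx_invariant G p).
Proof.
split=> [|c p q hp hq] A GA; first by rewrite /mx_act comp_mpoly0.
by rewrite /mx_act comp_mpolyD comp_mpolyZ [_ \mPo _](hp A GA)
  [_ \mPo _](hq A GA).
Qed.

Definition homog_invariants (k : fieldType) (n m : nat)
    (G : 'M[k]_n.+1 -> Prop) : {vspace dhomog n.+1 k m} :=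
  subspace_of (@invariant_linear k n m G).

(* The degree [t] component of the ring of invariants of the extended group,
   namely the forms of degree 2dt invariant under the dihedral group;
   see [mem_ext_dihedral_component] and [ext_dihedral_invariantP]. *)
Definition ext_dihedral_component (k : fieldType) (d a : nat) (eps : k)
    (t : nat) : {vspace dhomog 3 k (2 * d * t)} :=
  homog_invariants (2 * d * t) (dihedral_mx d a eps).

Definition HF_ext_dihedral (k : fieldType) (d a : nat) (eps : k) (t : nat) :
    nat :=
  \dim (ext_dihedral_component d a eps t).

(* The forms of degree 2dt invariant under the dihedral group are those
   invariant under the extended group. *)
Lemma mem_ext_dihedral_component (k : fieldType) (d a : nat) (eps : k)
    (t : nat) (p : dhomog 3 k (2 * d * t)) :
  (0 < d)%N -> (2 * d).-primitive_root eps ->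
  (p \in ext_dihedral_component d a eps t <->
     mx_invariant (dihedral_mx d a eps) p) /\
  (p \in ext_dihedral_component d a eps t <->
     mx_invariant (ext_dihedral_mx d a eps) p).
Proof.
move=> d0 prim.
have memE := mem_subspace_of
  (invariant_linear (2 * d * t) (dihedral_mx d a eps)) p.
split; first exact: memE.
apply: (iff_trans memE); apply: iff_sym.
apply: (iff_trans (ext_dihedral_invariantP _ _ d0 prim)).
split=> [[] //|inv]; split=> // m.
by move/(dhomog_mf (dhomog_is_dhomog p)) => /= ->; apply: dvdn_mulr.
Qed.

(* Main.v *)
From HB Require Import structures.
Require Import Defs.
From mathcomp Require Import all_boot all_order all_algebra.
From mathcomp Require Import perm mpoly zify.

(** The two generators act on monomials: tau multiplies x0^x x1^u x2^v by
    e^(a u + (d - a) v) = e^(a (u - v)), and eta exchanges u and v.  As e is a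
    primitive d-th root of unity and a is prime to d, a form is invariant exactly
    when its monomials satisfy u = v mod d and its coefficients are symmetric
    under u <-> v ([dihedral_invariantP]).  The sums of monomials over the orbits
    of the exchange are therefore a basis of the invariants of degree 2dt, and
    the dimension is the number of orbits of monomials of degree 2dt with
    u = v mod d ([dim_ext_dihedral_component]).

    An orbit has a unique member with u <= v.  Writing v = u + d (2t - s), the
    degree condition becomes x + 2u = d s, so s runs over 0..2t and u over
    0..floor(d s / 2), and the dimension is the sum over s <= 2t of
    floor(d s / 2) + 1.  Raising t by 1 adds two terms, which settles the closed
    form by induction; the floors cost 1/2 for each of the t odd values of s when
    d is odd, whence the gcd(d, 2) ([card_orbit_index]). *)

Import GRing.Theory.
Local Open Scope ring_scope.

(** * Dimension from dual families *)

(** The functionals identify V with the space of functions on I: they are jointly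
    injective on V, and the dual vectors make them jointly surjective. *)
Lemma dimv_dual_family {k : fieldType} {vT : vectType k} (V : {vspace vT})
    {I : finType} (c : I -> vT -> k) (b : I -> vT) :
    (forall i, scalar (c i)) ->
    (forall i, b i \in V) ->
    (forall i j, c j (b i) = (i == j)%:R) ->
    (forall v, v \in V -> (forall i, c i v = 0) -> v = 0) ->
  \dim V = #|I|.
Proof.
move=> c_lin bV cb c_inj.
pose g (v : vT) : {ffun I -> k^o} := [ffun i => c i v].
have g_lin : linear g.
  by move=> x u v; apply/ffunP => i; rewrite !ffunE c_lin.
pose gL : {linear _ -> _} := HB.pack g (GRing.isLinear.Build _ _ _ _ g g_lin).
have gE v i : linfun gL v i = c i v by rewrite lfunE /= ffunE.
have ker0 : (V :&: lker (linfun gL) = 0)%VS.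
  apply/eqP; rewrite -subv0; apply/subvP => v; rewrite memv_cap memv0.
  case/andP => vV /[!memv_ker]/eqP gv0; apply/eqP; apply: c_inj => // i.
  by rewrite -gE gv0 ffunE.
rewrite -(limg_dim_eq ker0).
have -> : (linfun gL @: V)%VS = fullv.
  apply/eqP; rewrite eqEsubv subvf /=; apply/subvP => f _.
  suff -> : f = linfun gL (\sum_i f i *: b i).
    by apply/memv_img/memv_suml => i _; apply: memvZ.
  apply/ffunP => j; rewrite linear_sum sum_ffunE (bigD1 j) //= big1 => [|i ij].
    by rewrite linearZ /= ffunE gE cb eqxx addr0 [RHS]mulr1.
  by rewrite linearZ /= ffunE gE cb (negbTE ij) [LHS]mulr0.
by rewrite dimvf /dim /= muln1.
Qed.

(** * Diagonal and permutation matrices acting on polynomials *)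

Lemma mcoeff_mx_act_diag {k : fieldType} {n : nat} (v : 'rV[k]_n)
    (p : {mpoly k[n]}) (m : 'X_{1..n}) :
  (mx_act (diag_mx v) p)@_m = p@_m * \prod_(i < n) v 0 i ^+ m i.
Proof.
rewrite /mx_act comp_mpolyEX.
under eq_bigr => m' _.
  rewrite comp_mpolyX.
  have -> : \prod_(i < n) tnth [tuple \sum_(i0 < n) diag_mx v i0 j *: 'X_i0
      | j < n] i ^+ m' i = (\prod_(i < n) v 0 i ^+ m' i) *: 'X_[k, m'].
    rewrite [X in _ *: X]mpolyXE_id -scaler_prod; apply: eq_bigr => i _.
    rewrite tnth_mktuple (bigD1 i) //= mxE eqxx mulr1n big1 ?addr0 ?exprZn //.
    by move=> j /negbTE nij; rewrite mxE nij scale0r.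
  rewrite scalerA; over.
rewrite raddf_sum /=.
under eq_bigr do rewrite mcoeffZ mcoeffX.
have [mp|/[dup] mp /memN_msupp_eq0 ->] := boolP (m \in msupp p).
  rewrite (bigD1_seq m) ?msupp_uniq //= eqxx mulr1 [X in _ + X]big1 ?addr0 //.
  by move=> m' /negbTE ->; rewrite mulr0.
rewrite mul0r big1_seq // => m' /= m'p.
by case: eqP m'p mp => [->->|_ _ _]; rewrite ?mulr0.
Qed.

(** Column j of the permutation matrix of s has its 1 in row s^-1 j, so 'X_j is
    sent to 'X_(s^-1 j); hence the inverse. *)
Lemma mx_act_perm {k : fieldType} {n : nat} (s : 'S_n) (p : {mpoly k[n]}) :
  mx_act (perm_mx s) p = msym s^-1 p.
Proof.
rewrite -[RHS]comp_mpoly_id msym_mPo /mx_act; congr (_ \mPo _).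
apply/eq_from_tnth => j; rewrite !tnth_mktuple (bigD1 (s^-1 j)%g) //=.
rewrite !mxE permKV eqxx scale1r big1 ?addr0 // => i /negbTE ij.
by rewrite !mxE (canF_eq (permK s)) ij scale0r.
Qed.

(** * The dihedral invariants in terms of coefficients *)

(** Adding a * v to both sides turns a u + (d - a) v = 0 into a u = a v modulo d,
    and a, being prime to d, can be cancelled. *)
Lemma dvdn_weight (d a u v : nat) : (a <= d)%N -> coprime d a ->
  (d %| a * u + (d - a) * v)%N = (u == v %[mod d]).
Proof.
move=> le_ad cop; rewrite /dvdn -(mod0n d) -(eqn_modDr (a * v)) -addnA -mulnDl subnK //.
rewrite add0n addnC [(d * v)%N]mulnC modnMDl.
wlog le_uv : u v / (u <= v)%N => [IH|].
  by case/orP: (leq_total u v) => /IH //; rewrite eq_sym => ->; rewrite eq_sym.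
by rewrite eq_sym [RHS]eq_sym !eqn_mod_dvd ?leq_mul2l ?le_uv ?orbT //
  -mulnBr Gauss_dvdr.
Qed.


Definition swap12 : 'S_3 := tperm (inord 1) (inord 2).

Definition swap_mnm (m : 'X_{1..3}) : 'X_{1..3} :=
  [multinom m (swap12 i) | i < 3].

Definition mnm3 (x y z : nat) : 'X_{1..3} :=
  [multinom nth 0%N [:: x; y; z] i | i < 3].

Lemma mnm3_eta (m : 'X_{1..3}) : m = mnm3 (m 0) (m (inord 1)) (m (inord 2)).
Proof.
apply/mnmP => i; rewrite mnmE.
by case: i => [[|[|[|//]]] lti] /=; congr (m _); apply/val_inj;
  rewrite /= ?inordK.
Qed.

Lemma mnm3E (x y z : nat) :
  (mnm3 x y z 0 = x) * (mnm3 x y z (inord 1) = y) * (mnm3 x y z (inord 2) = z).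
Proof. by rewrite !mnmE !inordK. Qed.

Lemma swap_mnm3 (x y z : nat) : swap_mnm (mnm3 x y z) = mnm3 x z y.
Proof.
rewrite [LHS]mnm3_eta ![swap_mnm _ _]mnmE /swap12 tpermL tpermR !mnm3E.
by rewrite tpermD ?mnm3E // -val_eqE /= inordK.
Qed.

Lemma swap_mnmK : involutive swap_mnm.
Proof. by move=> m; rewrite [m]mnm3_eta !swap_mnm3. Qed.

Lemma mdeg_mnm3 (x y z : nat) : mdeg (mnm3 x y z) = (x + y + z)%N.
Proof. by rewrite mdegE !big_ord_recr big_ord0 !mnmE. Qed.

Lemma mdeg_swap (m : 'X_{1..3}) : mdeg (swap_mnm m) = mdeg m.
Proof. exact: mdeg_mperm. Qed.

(** Invariance can be tested on the two generators, which scale or permute the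
    monomials, and so on each coefficient separately. *)
Lemma dihedral_invariantP {k : fieldType} {d a : nat} {eps : k}
    (p : {mpoly k[3]}) : (0 < d)%N -> (a <= d)%N -> coprime d a ->
    (2 * d).-primitive_root eps ->
  mx_invariant (dihedral_mx d a eps) p <->
  (forall m, m \in msupp p -> m (inord 1) = m (inord 2) %[mod d]) /\
  (forall m, p@_(swap_mnm m) = p@_m).
Proof.
move=> d_gt0 le_ad cop prim.
have eps_neq0 : eps != 0.
  by apply: contra_eq_neq (prim_expr_order prim) => ->;
    rewrite expr0n muln_eq0 /= eqn0Ngt d_gt0 eq_sym oner_neq0.
have unit_gen (A : 'M_3) : A = rho_tau d a eps \/ A = rho_eta k -> A \in unitmx.
  case=> ->; last by rewrite unitmx_perm.
  rewrite unitmxE det_diag unitfE; apply/prodf_neq0 => i _; rewrite mxE.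
  by case: i => [[|[|[|//]]] ?] /=; rewrite ?oner_eq0 ?expf_neq0.
have tauE m : (mx_act (rho_tau d a eps) p)@_m =
    p@_m * eps ^+ (2 * (a * m (inord 1) + (d - a) * m (inord 2))).
  rewrite mcoeff_mx_act_diag [m in LHS]mnm3_eta !big_ord_recr big_ord0 /= !mxE.
  by rewrite !mnmE /= expr1n !mul1r -!exprM -exprD mulnDr !mulnA -mnm3_eta.
have etaE m : (mx_act (rho_eta k) p)@_m = p@_(swap_mnm m).
  by rewrite /rho_eta mx_act_perm mcoeff_sym tpermV.
have weightE m : (eps ^+ (2 * (a * m (inord 1) + (d - a) * m (inord 2))) == 1)
    = (m (inord 1) == m (inord 2) %[mod d]).
  by rewrite -(prim_order_dvd prim) dvdn_pmul2l // dvdn_weight.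
rewrite /dihedral_mx; split=> [/(invariant_generated _ unit_gen) inv|[supp sym]].
  split=> [m|m]; last by rewrite -etaE inv //; right.
  rewrite mcoeff_msupp => pm; apply/eqP; rewrite -weightE.
  by apply/eqP/(mulfI pm); rewrite -tauE inv ?mulr1 //; left.
apply/(invariant_generated _ unit_gen) => A [->|->]; apply/mpolyP => m;
  last by rewrite etaE.
rewrite tauE; have [/supp/eqP|/memN_msupp_eq0 ->] := boolP (m \in msupp p).
  by rewrite -weightE => /eqP ->; rewrite mulr1.
by rewrite mul0r.
Qed.

(** Removing repetitions makes every coefficient 0 or 1, so that fixed points of
    an involution need no separate treatment in orbit sums. *)
Lemma mcoeff_sumX {R : nzRingType} {n : nat} (s : seq 'X_{1..n})
    (m : 'X_{1..n}) :
  (\sum_(m' <- undup s) 'X_[R, m'])@_m = (m \in s)%:R.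
Proof.
rewrite raddf_sum /= -mem_undup.
under eq_bigr do rewrite mcoeffX.
elim: undup (undup_uniq s) => [|m' s' IH] /=; first by rewrite big_nil.
case/andP => m's' /IH {}IH; rewrite big_cons IH in_cons eq_sym.
by case: eqP m's' => [<- /negbTE ->|_ _]; rewrite ?addr0 ?add0r.
Qed.

(** * Counting the orbits *)

(** The pair (s, u) stands for the orbit of the monomial in which x1 has the
    smaller exponent u and x2 the exponent u + d (2t - s); what is left for x0 in
    degree 2dt is d s - 2u, which is why u is at most half of d s. *)
Definition orbit_index (d t : nat) : finType :=
  {s : 'I_(2 * t).+1 & 'I_((d * s)./2.+1)}.

Definition orbit_rep {d t : nat} (i : orbit_index d t) : 'X_{1..3} :=
  let: existT s u := i in mnm3 (d * s - 2 * u) u (u + d * (2 * t - s)).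

(** Summing over s from 0 to 2t, the step from t to t + 1 adds the terms
    s = 2t + 1 and s = 2t + 2, and only the first can involve a rounded half. *)
Lemma card_orbit_index (d t : nat) :
  (2 * #|orbit_index d t| = 2 * d * t ^ 2 + (d + gcdn d 2 + 2) * t + 2)%N.
Proof.
rewrite card_tagged sumnE big_map big_enum /=.
under eq_bigr do rewrite card_ord.
elim: t => [|t IH]; first by rewrite big_ord_recr big_ord0 /= muln0; lia.
have -> : (2 * t.+1).+1 = (2 * t).+3 by lia.
rewrite 2!big_ord_recr /= 2!mulnDr IH.
have -> : gcdn d 2 = (2 - odd d)%N.
  by rewrite -gcdn_modl modn2; case: odd.
nia.
Qed.

Lemma mdeg_orbit_rep {d t : nat} (i : orbit_index d t) :
  mdeg (orbit_rep i) = (2 * d * t)%N.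
Proof.
case: i => [[s lt_s] [u lt_u]]; rewrite /orbit_rep mdeg_mnm3 /=.
rewrite mulnBr; have : (d * s <= d * (2 * t))%N by rewrite leq_mul2l; lia.
by move: lt_u => /=; lia.
Qed.

Lemma orbit_rep_le {d t : nat} (i : orbit_index d t) :
  (orbit_rep i (inord 1) <= orbit_rep i (inord 2))%N.
Proof. by case: i => s u; rewrite !mnm3E leq_addr. Qed.

Lemma orbit_rep_mod {d t : nat} (i : orbit_index d t) :
  orbit_rep i (inord 1) = orbit_rep i (inord 2) %[mod d].
Proof. by case: i => s u; rewrite !mnm3E -modnDmr modnMr addn0. Qed.

Lemma orbit_rep_inj {d t : nat} : (0 < d)%N ->
  injective (@orbit_rep d t).
Proof.
move=> d_gt0 [s u] [s' u'] /= eq_rep.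
have := congr1 (fun m : 'X_{1..3} => m (inord 1)) eq_rep; rewrite !mnm3E => equ.
have := congr1 (fun m : 'X_{1..3} => m (inord 2)) eq_rep; rewrite !mnm3E equ.
move/addnI/eqP; rewrite eqn_pmul2l // => /eqP eqs.
have {}eqs : s = s' by apply/ord_inj; move: (ltn_ord s) (ltn_ord s'); lia.
by case: _ / eqs u' {eq_rep} equ => u' /ord_inj ->.
Qed.

Lemma orbit_rep_surj {d t : nat} (m : 'X_{1..3}) : (0 < d)%N ->
    mdeg m = (2 * d * t)%N -> m (inord 1) = m (inord 2) %[mod d] ->
    (m (inord 1) <= m (inord 2))%N ->
  exists i : orbit_index d t, orbit_rep i = m.
Proof.
move=> d_gt0; rewrite [m]mnm3_eta mdeg_mnm3 !mnm3E.
move: (m 0) (m (inord 1)) (m (inord 2)) => x u v deg /esym/eqP.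
move=> /[swap] le_uv; rewrite eqn_mod_dvd // => /dvdnP[j Ej].
have le_j : (j <= 2 * t)%N by rewrite -(leq_pmul2l d_gt0); lia.
have lt_s : (2 * t - j < (2 * t).+1)%N by lia.
have lt_u : (u < (d * (2 * t - j))./2.+1)%N by rewrite mulnBr; lia.
exists (existT _ (Ordinal lt_s) (Ordinal lt_u)) => /=.
by rewrite subKn //; congr mnm3; rewrite ?mulnBr; lia.
Qed.

(** Orbit sums are dual to the coefficients at the orbit representatives, and by
    symmetry these coefficients determine an invariant form. *)
Lemma dim_ext_dihedral_component {k : fieldType} {d a : nat} {eps : k}
    (t : nat) : (0 < d)%N -> (a <= d)%N -> coprime d a ->
    (2 * d).-primitive_root eps ->
  \dim (ext_dihedral_component d a eps t) = #|orbit_index d t|.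
Proof.
move=> d_gt0 le_ad cop eps_prim.
have memE (p : dhomog 3 k (2 * d * t)) :=
  iff_trans (mem_ext_dihedral_component a p d_gt0 eps_prim).1
    (dihedral_invariantP p d_gt0 le_ad cop eps_prim).
pose orb (m : 'X_{1..3}) := [:: m; swap_mnm m].
have orb_homog (i : orbit_index d t) :
    \sum_(m <- undup (orb (orbit_rep i))) 'X_[k, m] \is (2 * d * t).-homog.
  rewrite big_seq; apply: rpred_sum => m; rewrite mem_undup !inE dhomogX /=.
  by case/orP => /eqP ->; rewrite ?mdeg_swap mdeg_orbit_rep.
pose b i : dhomog 3 k (2 * d * t) := DHomog (orb_homog i).
have bE i m : (b i : {mpoly k[3]})@_m = (m \in orb (orbit_rep i))%:R.
  exact: mcoeff_sumX.
apply: (dimv_dual_family (ext_dihedral_component d a eps t)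
  (fun i (p : dhomog 3 k (2 * d * t)) => (p : {mpoly k[3]})@_(orbit_rep i)) b).
- by move=> i c p q; rewrite mcoeffD mcoeffZ.
- move=> i; apply/memE; split=> m.
    rewrite mcoeff_msupp bE.
    case: (boolP (m \in _)) => [|_ /eqP //]; rewrite !inE.
    case/orP => /eqP -> _; first exact: orbit_rep_mod.
    have := orbit_rep_mod i; rewrite [orbit_rep i]mnm3_eta swap_mnm3 !mnm3E.
    by move->.
  by rewrite !bE !inE (inj_eq (inv_inj swap_mnmK)) (inv_eq swap_mnmK) orbC.
- move=> i j; rewrite bE; congr (_%:R); congr nat_of_bool.
  rewrite !inE; apply/orP/eqP => [[/eqP|]|->]; last by left.
    by move/(orbit_rep_inj d_gt0).
  (* If one representative is the exchange of another, the inequality u <= v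
     holds both ways, so both representatives lie on the diagonal u = v. *)
  move/eqP=> Ej; apply/(orbit_rep_inj d_gt0).
  have := orbit_rep_le i; have := orbit_rep_le j; rewrite Ej.
  rewrite [orbit_rep i]mnm3_eta swap_mnm3 !mnm3E => le_vu le_uv.
  by have /eqP -> : orbit_rep i (inord 1) == orbit_rep i (inord 2);
    rewrite ?eqn_leq ?le_uv.
move=> p /memE[supp sym] coef0; apply/val_inj/mpolyP => m; rewrite mcoeff0.
have [pm|/memN_msupp_eq0 //] := boolP (m \in msupp p).
have degm := dhomog_mf (dhomog_is_dhomog p) pm.
have [le12|/ltnW le21] := leqP (m (inord 1)) (m (inord 2)).
  by have [i <-] := orbit_rep_surj m d_gt0 degm (supp _ pm) le12.
rewrite -sym.
have [|||i <-] // := @orbit_rep_surj d t (swap_mnm m) d_gt0.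
- by rewrite mdeg_swap.
- by move: (supp _ pm); rewrite [m]mnm3_eta swap_mnm3 !mnm3E.
- by rewrite [m]mnm3_eta swap_mnm3 !mnm3E.
Qed.

Theorem proposition3p3 (k : closedFieldType) (char0 : [pchar k] =i pred0)
    (d a : nat) (d_ge3 : (3 <= d)%N) (a_gt0 : (0 < a)%N)
    (a_lt : (2 * a < d)%N) (a_d_coprime : gcdn a d = 1%N)
    (eps : k) (eps_prim : (2 * d).-primitive_root eps)
    (t : nat) (t_ge1 : (1 <= t)%N) :
  (HF_ext_dihedral d a eps t)%:R
  = (2 * d * t ^ 2 + (d + gcdn d 2 + 2) * t + 2)%N%:R / 2%:R :> rat.
Proof.
have d_gt0 : (0 < d)%N by lia.
have le_ad : (a <= d)%N by lia.
have cop : coprime d a by rewrite coprime_sym /coprime a_d_coprime.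
rewrite /HF_ext_dihedral (dim_ext_dihedral_component t d_gt0 le_ad cop eps_prim).
by rewrite -card_orbit_index natrM mulrAC divff ?mul1r.
Qed.
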